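(* Let $\mathbb{C}$ be a regular category and let $n \geqslant 1$ be an integer. The following statements are equivalent: (i) $\mathbb{C}$ is a Jónsson category of order $n$, i.e., for any three equivalence relations $R,S,T$ on any object $A$ of $\mathbb{C}$, \[ R\wedge (S\circ T)\leqslant (R\wedge S,\; R\wedge T)_{n+1}; \] (ii) given an equivalence relation $R$ and reflexive relations $S,T$ on any object $A$ of $\mathbb{C}$, we have \[ R\wedge (S\circ T)\leqslant \bigl(\,(R\wedge S^{\mathrm{op}})\circ (R\wedge S),\;(R\wedge T)\circ(R\wedge T^{\mathrm{op}})\,\bigr)_{n+1}. \]
   Context: A category is regular if it has finite limits and coequalisers of kernel pairs, and regular epimorphisms are stable under pullback. A (binary, internal) relation on an object $A$ is a subobject of $A\times A$; relations are ordered by inclusion of subobjects ($\leqslant$), and $\wedge$ denotes the meet (intersection) of subobjects. For a relation $R$ represented by $(r_1,r_2)\colon R\to A\times A$, the opposite relation $R^{\mathrm{op}}$ is represented by $(r_2,r_1)$. $R$ is reflexive if it contains the diagonal relation $\Delta_A$ (represented by $(1_A,1_A)$); equivalence relations are the internal ones (reflexive, symmetric, transitive). Composition of relations in a regular category: for relations $R$ and $S$ on $A$ represented by $(r_1,r_2)$ and $(s_1,s_2)$, let $(P,p_1,p_2)$ be the pullback of $s_1$ along $r_2$ (so $r_2p_1=s_1p_2$); then $R\circ S$ is the relation represented by the monomorphism part of the (regular epi, mono) factorisation of $(r_1p_1,s_2p_2)\colon P\to A\times A$. (So in sets, $x(R\circ S)z$ iff there is $y$ with $xRy$ and $ySz$.)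 For relations $U,V$ on $A$ and $k\geqslant 1$, $(U,V)_k$ denotes the alternating composite $U\circ V\circ U\circ\cdots$ with $k$ factors in total, beginning with $U$; $(U,V)_0=\Delta_A$. *)

(* Defs.v *)
From Stdlib Require Import List FinFun Bool Eqdep_dec IndefiniteDescription.

Set Implicit Arguments.
Unset Strict Implicit.
Unset Printing Implicit Defensive.
Set Primitive Projections.

Declare Scope cat_scope.
Declare Scope intrel_scope.
Delimit Scope cat_scope with cat.
Delimit Scope intrel_scope with intrel.
Local Open Scope cat_scope.

Record category : Type := Category {
  ob :> Type;
  hom : ob -> ob -> Type;
  idm : forall x, hom x x;
  compm : forall x y z, hom y z -> hom x y -> hom x z;
  compmA : forall w x y z (h : hom y z) (g : hom x y) (f : hom w x),
    compm h (compm g f) = compm (compm h g) f;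
  comp1m : forall x y (f : hom x y), compm (idm y) f = f;
  compm1 : forall x y (f : hom x y), compm f (idm x) = f
}.

Notation "g '\o' f" := (compm g f) (at level 50, left associativity) : cat_scope.

Arguments idm {c} x.
Arguments hom {c} x y.

Record functor (J C : category) : Type := Functor {
  fob :> J -> C;
  fmap : forall x y, hom x y -> hom (fob x) (fob y);
  fmap1 : forall x, fmap (idm x) = idm (fob x);
  fmapM : forall x y z (g : hom y z) (f : hom x y),
    fmap (g \o f) = fmap g \o fmap f
}.

Record cone (J C : category) (D : functor J C) : Type := Cone {
  apex :> C;
  leg : forall j, hom apex (D j);
  leg_nat : forall i j (u : hom i j), fmap D u \o leg i = leg j
}.

Definition is_limit (J C : category) (D : functor J C) (L : cone D) : Prop :=
  forall K : cone D, exists! h : hom K L, forall j, leg L j \o h = leg K j.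

Definition finite_category (J : category) : Prop :=
  Finite J /\ forall x y : J, Finite (hom x y).

Definition has_finite_limits (C : category) : Prop :=
  forall (J : category) (D : functor J C), finite_category J ->
    exists L : cone D, is_limit L.

Section Notions.
Variable C : category.
Implicit Types A B P X Y Z : C.

Definition mono X Y (m : hom X Y) : Prop :=
  forall Z (u v : hom Z X), m \o u = m \o v -> u = v.

Definition is_product A B P (p1 : hom P A) (p2 : hom P B) : Prop :=
  forall X (a : hom X A) (b : hom X B),
    exists! h : hom X P, p1 \o h = a /\ p2 \o h = b.

Definition is_pullback X Y Z (f : hom X Z) (g : hom Y Z)
    P (p1 : hom P X) (p2 : hom P Y) : Prop :=
  f \o p1 = g \o p2 /\
  forall W (a : hom W X) (b : hom W Y), f \o a = g \o b ->
    exists! h : hom W P, p1 \o h = a /\ p2 \o h = b.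

Definition is_kernel_pair X Y (f : hom X Y) K (k1 k2 : hom K X) : Prop :=
  is_pullback f f k1 k2.

Definition is_coequaliser X Y (f g : hom X Y) Q (q : hom Y Q) : Prop :=
  q \o f = q \o g /\
  forall Z (h : hom Y Z), h \o f = h \o g -> exists! t : hom Q Z, t \o q = h.

Definition regular_epi X Y (e : hom X Y) : Prop :=
  exists (Z : C) (f g : hom Z X), is_coequaliser f g e.

Definition has_coequalisers_of_kernel_pairs : Prop :=
  forall X Y (f : hom X Y) K (k1 k2 : hom K X), is_kernel_pair f k1 k2 ->
    exists (Q : C) (q : hom X Q), is_coequaliser k1 k2 q.

Definition regular_epis_stable_under_pullback : Prop :=
  forall X Y Z (f : hom X Z) (g : hom Y Z) P (p1 : hom P X) (p2 : hom P Y),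
    is_pullback f g p1 p2 -> regular_epi f -> regular_epi p2.

Definition is_regular : Prop :=
  has_finite_limits C /\ has_coequalisers_of_kernel_pairs /\
  regular_epis_stable_under_pullback.

End Notions.

Record regular_category : Type := RegularCategory {
  reg_cat :> category;
  reg_catP : is_regular reg_cat
}.

Section Thin.
Variables (T : Type) (le : T -> T -> bool).
Hypothesis le_refl : forall x, le x x = true.
Hypothesis le_trans : forall x y z, le y z = true -> le x y = true -> le x z = true.

Definition thin : category.
Proof.
refine (@Category T (fun x y => le x y = true) le_refl le_trans _ _ _);
  intros; apply (UIP_dec bool_dec).
Defined.

Lemma thin_finite : Finite T -> finite_category thin.
Proof.
intros fT; split; [exact fT|]; intros x y; simpl.
destruct (bool_dec (le x y) true) as [e|ne].
- exists (e :: nil); intros e'; left; apply (UIP_dec bool_dec).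
- exists nil; intros e'; destruct (ne e').
Qed.

End Thin.

Section FiniteLimits.
Variable C : category.
Hypothesis limC : has_finite_limits C.

Let eqb_tr (x y z : bool) : eqb y z = true -> eqb x y = true -> eqb x z = true.
Proof. destruct x, y, z; auto. Qed.

Lemma product_exists (A B : C) :
  exists (P : C) (p1 : hom P A) (p2 : hom P B), is_product p1 p2.
Proof.
pose (J := thin eqb_reflx eqb_tr).
pose (F := fun b : bool => if b then A else B).
unshelve epose (D := @Functor J C F
  (fun x y => match x, y return eqb x y = true -> hom (F x) (F y) with
     | true, true => fun _ => idm A
     | false, false => fun _ => idm B
     | true, false | false, true => fun h => False_rect _ (diff_false_true h)
     end) _ _).
- intros [|]; reflexivity.
- intros [|] [|] [|] g f; try discriminate g; try discriminate f;
    simpl; now rewrite compm1.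
- destruct (limC D) as [L HL].
  { apply thin_finite; exists (true :: false :: nil).
    intros [|]; simpl; auto. }
  exists (apex L), (leg L true), (leg L false); intros X a b.
  unshelve epose (K := @Cone J C D X
    (fun j => match j return hom X (F j) with true => a | false => b end) _).
  { intros [|] [|] u; try discriminate u; simpl; apply comp1m. }
  destruct (HL K) as [h [Hh Uh]]; exists h; split.
  + split; [exact (Hh true) | exact (Hh false)].
  + intros h' [H1 H2]; apply Uh; intros [|]; assumption.
Qed.

Let cosp (x y : option bool) : bool :=
  match x, y with
  | _, None => true
  | Some a, Some b => eqb a b
  | None, Some _ => false
  end.
Let cosp_refl x : cosp x x = true.
Proof. destruct x as [[|]|]; auto. Qed.
Let cosp_tr x y z : cosp y z = true -> cosp x y = true -> cosp x z = true.
Proof. destruct x as [[|]|], y as [[|]|], z as [[|]|]; auto. Qed.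

Lemma pullback_exists (X Y Z : C) (f : hom X Z) (g : hom Y Z) :
  exists (P : C) (p1 : hom P X) (p2 : hom P Y), is_pullback f g p1 p2.
Proof.
pose (J := thin cosp_refl cosp_tr).
pose (F := fun i : option bool =>
  match i with Some true => X | Some false => Y | None => Z end).
unshelve epose (D := @Functor J C F
  (fun x y => match x, y return cosp x y = true -> hom (F x) (F y) with
     | None, None => fun _ => idm Z
     | Some true, Some true => fun _ => idm X
     | Some false, Some false => fun _ => idm Y
     | Some true, None => fun _ => f
     | Some false, None => fun _ => g
     | Some true, Some false | Some false, Some true
     | None, Some _ => fun h => False_rect _ (diff_false_true h)
     end) _ _).
- intros [[|]|]; reflexivity.
- intros [[|]|] [[|]|] [[|]|] v u; try discriminate v; try discriminate u;
    simpl; now rewrite ?compm1, ?comp1m.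
- destruct (limC D) as [L HL].
  { apply thin_finite; exists (Some true :: Some false :: None :: nil).
    intros [[|]|]; simpl; auto. }
  exists (apex L), (leg L (Some true)), (leg L (Some false)); split.
  { transitivity (leg L None); [|symmetry].
    - exact (@leg_nat _ _ _ L (Some true) None eq_refl).
    - exact (@leg_nat _ _ _ L (Some false) None eq_refl). }
  intros W a b ab.
  unshelve epose (K := @Cone J C D W
    (fun j => match j return hom W (F j) with
       | Some true => a | Some false => b | None => f \o a end) _).
  { intros [[|]|] [[|]|] u; try discriminate u; simpl; auto using comp1m. }
  destruct (HL K) as [h [Hh Uh]]; exists h; split.
  + split; [exact (Hh (Some true)) | exact (Hh (Some false))].
  + intros h' [H1 H2]; apply Uh; intros [[|]|]; simpl; auto.
    rewrite <- H1, compmA; f_equal; symmetry.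
    exact (@leg_nat _ _ _ L (Some true) None eq_refl).
Qed.

End FiniteLimits.

Section Factorisation.
Variable C : category.
Hypothesis regC : is_regular C.

Lemma regular_epi_epi (X Y : C) (e : hom X Y) : regular_epi e ->
  forall Z (u v : hom Y Z), u \o e = v \o e -> u = v.
Proof.
intros (W & f & g & fg & U) Z u v uv.
destruct (U Z (u \o e)) as [t [_ Ut]].
{ rewrite <- !compmA; now rewrite fg. }
now rewrite <- (Ut u eq_refl), <- (Ut v (eq_sym uv)).
Qed.

Lemma factorisation_exists (X Y : C) (f : hom X Y) :
  exists (I : C) (e : hom X I) (m : hom I Y),
    regular_epi e /\ mono m /\ m \o e = f.
Proof.
destruct regC as (limC & coeqC & stabC).
destruct (pullback_exists limC f f) as (K & k1 & k2 & HK).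
destruct (coeqC _ _ _ _ _ _ HK) as (I & e & He).
destruct HK as [fk HK].
destruct (proj2 He _ f fk) as (m & me & _).
assert (Re : regular_epi e) by (exists K, k1, k2; exact He).
exists I, e, m; split; [exact Re|split; [|exact me]].
intros Z u v uv.
destruct (pullback_exists limC e u) as (P & p1 & p2 & HP).
pose proof (regular_epi_epi (stabC _ _ _ _ _ _ _ _ HP Re)) as Ep.
destruct (pullback_exists limC e (v \o p2)) as (Q & q1 & q2 & HQ).
pose proof (regular_epi_epi (stabC _ _ _ _ _ _ _ _ HQ Re)) as Eq.
apply Ep, Eq.
destruct HP as [HP _], HQ as [HQ _].
destruct (HK Q (p1 \o q2) q1) as (h & [h1 h2] & _).
{ rewrite <- me, <- !compmA, HQ, (compmA e), HP.
  rewrite !compmA; now rewrite uv. }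
rewrite <- HQ, <- HP, <- compmA, <- h1, <- h2, !compmA.
now rewrite (proj1 He).
Qed.

End Factorisation.

Section Structure.
Variable C : regular_category.

(* Finite limits and (regular epi, mono) factorisations are only assumed, resp.
   proved, to exist; a representative of each is selected once and for all. *)

Definition prod_sig (A B : C) :
  {P : C & {p : hom P A * hom P B | is_product (fst p) (snd p)}}.
Proof.
destruct (constructive_indefinite_description _
  (product_exists (proj1 (reg_catP C)) A B)) as [P HP].
exists P.
destruct (constructive_indefinite_description _ HP) as [p1 H1].
destruct (constructive_indefinite_description _ H1) as [p2 H2].
exact (exist _ (p1, p2) H2).
Defined.

Definition prodo (A B : C) : C := projT1 (prod_sig A B).
Definition pr1 (A B : C) : hom (prodo A B) A := fst (proj1_sig (projT2 (prod_sig A B))).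
Definition pr2 (A B : C) : hom (prodo A B) B := snd (proj1_sig (projT2 (prod_sig A B))).

Lemma prodP (A B : C) : is_product (pr1 A B) (pr2 A B).
Proof. exact (proj2_sig (projT2 (prod_sig A B))). Qed.

Definition pair_sig (X A B : C) (a : hom X A) (b : hom X B) :
  {h : hom X (prodo A B) | pr1 A B \o h = a /\ pr2 A B \o h = b}.
Proof.
apply constructive_indefinite_description.
destruct (prodP a b) as [h [Hh _]]; exists h; exact Hh.
Defined.

Definition pairm (X A B : C) (a : hom X A) (b : hom X B) : hom X (prodo A B) :=
  proj1_sig (pair_sig a b).

Lemma pr1_pair (X A B : C) (a : hom X A) (b : hom X B) : pr1 A B \o pairm a b = a.
Proof. exact (proj1 (proj2_sig (pair_sig a b))). Qed.

Lemma pr2_pair (X A B : C) (a : hom X A) (b : hom X B) : pr2 A B \o pairm a b = b.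
Proof. exact (proj2 (proj2_sig (pair_sig a b))). Qed.

Lemma prod_ext (X A B : C) (u v : hom X (prodo A B)) :
  pr1 A B \o u = pr1 A B \o v -> pr2 A B \o u = pr2 A B \o v -> u = v.
Proof.
intros H1 H2.
destruct (prodP (pr1 A B \o v) (pr2 A B \o v)) as [h [_ Uh]].
rewrite <- (Uh u (conj H1 H2)); now apply Uh.
Qed.

Definition pb_sig (X Y Z : C) (f : hom X Z) (g : hom Y Z) :
  {P : C & {p : hom P X * hom P Y | is_pullback f g (fst p) (snd p)}}.
Proof.
destruct (constructive_indefinite_description _
  (pullback_exists (proj1 (reg_catP C)) f g)) as [P HP].
exists P.
destruct (constructive_indefinite_description _ HP) as [p1 H1].
destruct (constructive_indefinite_description _ H1) as [p2 H2].
exact (exist _ (p1, p2) H2).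
Defined.

Definition pb (X Y Z : C) (f : hom X Z) (g : hom Y Z) : C := projT1 (pb_sig f g).
Definition pb1 (X Y Z : C) (f : hom X Z) (g : hom Y Z) : hom (pb f g) X :=
  fst (proj1_sig (projT2 (pb_sig f g))).
Definition pb2 (X Y Z : C) (f : hom X Z) (g : hom Y Z) : hom (pb f g) Y :=
  snd (proj1_sig (projT2 (pb_sig f g))).

Lemma pbP (X Y Z : C) (f : hom X Z) (g : hom Y Z) : is_pullback f g (pb1 f g) (pb2 f g).
Proof. exact (proj2_sig (projT2 (pb_sig f g))). Qed.

Definition im_sig (X Y : C) (f : hom X Y) :
  {I : C & {m : hom I Y | mono m /\ exists e, regular_epi e /\ m \o e = f}}.
Proof.
destruct (constructive_indefinite_description _
  (factorisation_exists (reg_catP C) f)) as [I HI].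
exists I.
apply constructive_indefinite_description.
destruct HI as (e & m & He & Hm & me); exists m; split; [exact Hm|].
exists e; split; [exact He|exact me].
Defined.

Definition im_ob (X Y : C) (f : hom X Y) : C := projT1 (im_sig f).
Definition im_mono (X Y : C) (f : hom X Y) : hom (im_ob f) Y :=
  proj1_sig (projT2 (im_sig f)).

Lemma im_monoP (X Y : C) (f : hom X Y) : mono (im_mono f).
Proof. exact (proj1 (proj2_sig (projT2 (im_sig f)))). Qed.

Lemma im_monoE (X Y : C) (f : hom X Y) :
  exists e : hom X (im_ob f), regular_epi e /\ im_mono f \o e = f.
Proof. exact (proj2 (proj2_sig (projT2 (im_sig f)))). Qed.

End Structure.

Section Relations.
Variable C : regular_category.

(* A relation is given by a representing monomorphism; two representatives of
   the same subobject are not identified, but are [le_rel] each other. *)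
Record relation (A : C) : Type := Relation {
  rel_ob : C;
  rel_mor : hom rel_ob (prodo A A);
  rel_mono : mono rel_mor
}.

Variable A : C.
Implicit Types R S T U V : relation A.

Definition rel1 R : hom (rel_ob R) A := pr1 A A \o rel_mor R.
Definition rel2 R : hom (rel_ob R) A := pr2 A A \o rel_mor R.

Definition le_rel R S : Prop :=
  exists i : hom (rel_ob R) (rel_ob S), rel_mor S \o i = rel_mor R.

Lemma diag_mono : mono (pairm (idm A) (idm A)).
Proof.
intros Z u v uv.
rewrite <- (comp1m u), <- (comp1m v), <- (pr1_pair (idm A) (idm A)).
now rewrite <- !compmA, uv.
Qed.

Definition diag_rel : relation A := Relation (@diag_mono).

Lemma op_mono R : mono (pairm (rel2 R) (rel1 R)).
Proof.
intros Z u v uv; apply (@rel_mono A R), prod_ext.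
- rewrite !compmA; fold (rel1 R).
  rewrite <- (pr2_pair (rel2 R) (rel1 R)); now rewrite <- !compmA, uv.
- rewrite !compmA; fold (rel2 R).
  rewrite <- (pr1_pair (rel2 R) (rel1 R)); now rewrite <- !compmA, uv.
Qed.

Definition op_rel R : relation A := Relation (@op_mono R).

Lemma meet_mono R S : mono (rel_mor R \o pb1 (rel_mor R) (rel_mor S)).
Proof.
destruct (pbP (rel_mor R) (rel_mor S)) as [sq U].
intros Z u v uv.
assert (E1 : pb1 (rel_mor R) (rel_mor S) \o u = pb1 (rel_mor R) (rel_mor S) \o v).
{ apply (@rel_mono A R); now rewrite !compmA. }
assert (E2 : pb2 (rel_mor R) (rel_mor S) \o u = pb2 (rel_mor R) (rel_mor S) \o v).
{ apply (@rel_mono A S); now rewrite !compmA, <- sq. }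
destruct (U _ (pb1 (rel_mor R) (rel_mor S) \o v) (pb2 (rel_mor R) (rel_mor S) \o v))
  as [h [_ Uh]].
{ now rewrite !compmA, sq. }
rewrite <- (Uh u (conj E1 E2)); now apply Uh.
Qed.

Definition meet_rel R S : relation A := Relation (@meet_mono R S).

(* In element notation, x (comp_rel R S) z iff x R y and y S z for some y. *)
Definition comp_rel R S : relation A :=
  Relation (@im_monoP _ _ _ (pairm (rel1 R \o pb1 (rel2 R) (rel1 S))
                            (rel2 S \o pb2 (rel2 R) (rel1 S)))).

Fixpoint alt_rel U V (k : nat) : relation A :=
  match k with
  | 0 => diag_rel
  | 1 => U
  | S k' => comp_rel U (alt_rel V U k')
  end.

Definition reflexive_rel R : Prop := le_rel diag_rel R.
Definition symmetric_rel R : Prop := le_rel (op_rel R) R.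

(* The multiplication t : R x_A R -> R, with r1 t = r1 p1 and r2 t = r2 p2. *)
Definition transitive_rel R : Prop :=
  exists t : hom (pb (rel2 R) (rel1 R)) (rel_ob R),
    rel1 R \o t = rel1 R \o pb1 (rel2 R) (rel1 R) /\
    rel2 R \o t = rel2 R \o pb2 (rel2 R) (rel1 R).

Definition equivalence_rel R : Prop :=
  reflexive_rel R /\ symmetric_rel R /\ transitive_rel R.

End Relations.

Arguments alt_rel {C A} U V k.

Notation "R ≤ S" := (le_rel R%intrel S%intrel) (at level 70) : intrel_scope.
Notation "R ∧ S" := (meet_rel R S) (at level 38, left associativity) : intrel_scope.
Notation "R ∘ S" := (comp_rel R S) (at level 40, left associativity) : intrel_scope.
Notation "R ^op" := (op_rel R) (at level 2, left associativity, format "R ^op")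
  : intrel_scope.
Bind Scope intrel_scope with relation.

Definition jonsson_category (n : nat) (C : regular_category) : Prop :=
  forall (A : C) (R S T : relation A),
    equivalence_rel R -> equivalence_rel S -> equivalence_rel T ->
    (R ∧ (S ∘ T) ≤ alt_rel (R ∧ S) (R ∧ T) (n + 1))%intrel.

(* Main.v *)
(** Generalised elements reduce everything to a chase in which existential
    witnesses live on a regular-epi cover.  For (i) => (ii), suppose
    [x S y T z] and [x R z], and let [B] be the object of triples [(b, a, c)]
    with [b S a T c]; reflexivity of [S] and [T] puts [p = (x, x, x)],
    [q = (x, y, z)] and [r = (z, z, z)] in [B].  The equivalence relations
    "same [b]" and "same [c]" relate [p] to [q] and [q] to [r], and [p], [r] are
    componentwise [R]-related, so (i) joins [p] to [r] by an alternating chain.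
    Along it every triple has [R]-related components, because [p] has; and two
    consecutive middle components [a], [a'] satisfy [a S^op b S a'] or
    [a T c T^op a'], according to the coordinate which their triples share. *)

Require Import Defs.

Set Implicit Arguments.
Unset Strict Implicit.
Local Open Scope cat_scope.

(** * Calculus of generalised elements of relations *)

Section Membership.
Variable C : regular_category.

(** Generalised elements of [R] at stage [X], written with the two legs so that relations can be
    handled as in sets. *)
Definition mem (A X : C) (R : relation A) (f g : hom X A) : Prop :=
  exists h : hom X (rel_ob R), rel1 R \o h = f /\ rel2 R \o h = g.

Lemma mem_factor (A X : C) (R : relation A) (f g : hom X A) :
  mem R f g <-> exists h, rel_mor R \o h = pairm f g.
Proof.
unfold mem, rel1, rel2; split; intros [h H]; exists h.
- destruct H as [H1 H2]; apply prod_ext;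
    now rewrite ?pr1_pair, ?pr2_pair, compmA.
- now rewrite <- !compmA, H, pr1_pair, pr2_pair.
Qed.

Lemma mem_generic (A : C) (R : relation A) : mem R (rel1 R) (rel2 R).
Proof. exists (idm _); now rewrite !compm1. Qed.

Lemma mem_comp (A X Y : C) (R : relation A) (f g : hom X A) (u : hom Y X) :
  mem R f g -> mem R (f \o u) (g \o u).
Proof.
intros (h & <- & <-); exists (h \o u); now rewrite !compmA.
Qed.

(** A Yoneda argument: testing on the generic element, the pair of legs of [R] at stage [rel_ob R],
    already produces the inclusion. *)
Lemma le_relP (A : C) (R S : relation A) :
  le_rel R S <-> forall X (f g : hom X A), mem R f g -> mem S f g.
Proof.
split.
- intros [i Hi] X f g (h & <- & <-); exists (i \o h).
  unfold rel1, rel2; now rewrite <- Hi, !compmA.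
- intros H; destruct (proj1 (mem_factor _ _ _) (H _ _ _ (mem_generic R)))
    as [i Hi].
  exists i; rewrite Hi; apply prod_ext; [apply pr1_pair | apply pr2_pair].
Qed.

Lemma mem_op (A X : C) (R : relation A) (f g : hom X A) :
  mem (op_rel R) f g <-> mem R g f.
Proof.
assert (E1 : rel1 (op_rel R) = rel2 R) by apply pr1_pair.
assert (E2 : rel2 (op_rel R) = rel1 R) by apply pr2_pair.
unfold mem; split; intros (h & H1 & H2); exists h; split;
  now rewrite ?E1, ?E2 in *.
Qed.

Lemma mem_diag (A X : C) (f g : hom X A) : mem (diag_rel A) f g <-> f = g.
Proof.
assert (E1 : rel1 (diag_rel A) = idm A) by apply pr1_pair.
assert (E2 : rel2 (diag_rel A) = idm A) by apply pr2_pair.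
unfold mem; rewrite E1, E2; split.
- now intros (h & <- & <-).
- intros <-; exists f; now rewrite comp1m.
Qed.

Lemma mem_meet (A X : C) (R S : relation A) (f g : hom X A) :
  mem (meet_rel R S) f g <-> mem R f g /\ mem S f g.
Proof.
rewrite !mem_factor; simpl.
destruct (pbP (rel_mor R) (rel_mor S)) as [sq U]; split.
- intros [h <-]; split.
  + eexists; apply compmA.
  + rewrite sq; eexists; apply compmA.
- intros [[h Hh] [k Hk]].
  destruct (U _ h k) as (w & [H1 _] & _); [congruence|].
  exists w; now rewrite <- compmA, H1.
Qed.

Lemma mem_comp_rel (A X : C) (R S : relation A) (f y g : hom X A) :
  mem R f y -> mem S y g -> mem (comp_rel R S) f g.
Proof.
intros (h & <- & Hy) (k & Hk & <-).
destruct (pbP (rel2 R) (rel1 S)) as [_ U].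
destruct (U _ h k) as (w & [H1 H2] & _); [congruence|].
apply mem_factor; simpl.
destruct (im_monoE (pairm (rel1 R \o pb1 (rel2 R) (rel1 S))
                          (rel2 S \o pb2 (rel2 R) (rel1 S)))) as (e & _ & E).
exists (e \o w); rewrite compmA, E.
apply prod_ext; rewrite compmA, ?pr1_pair, ?pr2_pair, <- compmA; congruence.
Qed.

(** A composite is an image, so a middle element need not exist over [X] itself. It exists over the
    pullback of the image's regular epimorphism, which is again a regular epimorphism by
    stability. *)
Lemma mem_comp_rel_inv (A X : C) (R S : relation A) (f g : hom X A) :
  mem (comp_rel R S) f g ->
  exists (Y : C) (e : hom Y X) (y : hom Y A),
    regular_epi e /\ mem R (f \o e) y /\ mem S y (g \o e).
Proof.
rewrite mem_factor; simpl; intros [h Hh].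
destruct (im_monoE (pairm (rel1 R \o pb1 (rel2 R) (rel1 S))
                          (rel2 S \o pb2 (rel2 R) (rel1 S)))) as (e & Re & E).
destruct (pbP (rel2 R) (rel1 S)) as [sq _].
destruct (pbP e h) as [eh _].
pose proof (proj2 (proj2 (reg_catP C)) _ _ _ _ _ _ _ _ (pbP e h) Re) as Rp.
apply (f_equal (fun w => im_mono _ \o w)) in eh.
rewrite !compmA, E, Hh in eh.
(* The witness is the middle component of the composable pair picked out by [pb1 e h]. *)
exists (pb e h), (pb2 e h), (rel2 R \o pb1 (rel2 R) (rel1 S) \o pb1 e h).
split; [exact Rp | split].
- exists (pb1 (rel2 R) (rel1 S) \o pb1 e h); split; [|now rewrite compmA].
  apply (f_equal (fun w => pr1 A A \o w)) in eh.
  rewrite !compmA, !pr1_pair in eh; now rewrite compmA.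
- exists (pb2 (rel2 R) (rel1 S) \o pb1 e h); split; [now rewrite compmA, sq|].
  apply (f_equal (fun w => pr2 A A \o w)) in eh.
  rewrite !compmA, !pr2_pair in eh; now rewrite compmA.
Qed.

(* Regular epimorphisms are orthogonal to monomorphisms. *)
Lemma mem_local (A X Y : C) (R : relation A) (f g : hom X A) (e : hom Y X) :
  regular_epi e -> mem R (f \o e) (g \o e) -> mem R f g.
Proof.
rewrite !mem_factor; intros Re [h Hh].
assert (E : rel_mor R \o h = pairm f g \o e).
{ rewrite Hh; apply prod_ext; now rewrite !compmA, ?pr1_pair, ?pr2_pair. }
destruct (Re) as (Z & k1 & k2 & ek & U).
destruct (U _ h) as (t & te & _).
{ apply (rel_mono (r := R)); now rewrite !compmA, E, <- !compmA, ek. }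
exists t; apply (regular_epi_epi Re).
now rewrite <- compmA, te.
Qed.

Lemma reflexiveP (A : C) (R : relation A) :
  reflexive_rel R <-> forall X (f : hom X A), mem R f f.
Proof.
unfold reflexive_rel; rewrite le_relP; split.
- intros H X f; now apply H, mem_diag.
- intros H X f g E; apply mem_diag in E; subst g; apply H.
Qed.

Lemma symmetricP (A : C) (R : relation A) :
  symmetric_rel R <-> forall X (f g : hom X A), mem R f g -> mem R g f.
Proof.
unfold symmetric_rel; rewrite le_relP; split; intros H X f g Rfg.
- now apply H, mem_op.
- now apply H, mem_op.
Qed.

Lemma transitiveP (A : C) (R : relation A) :
  transitive_rel R <->
  forall X (f g h : hom X A), mem R f g -> mem R g h -> mem R f h.
Proof.
destruct (pbP (rel2 R) (rel1 R)) as [sq U]; split.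
- intros (t & t1 & t2) X f g h (u & <- & Hu) (v & Hv & <-).
  destruct (U _ u v) as (w & [<- <-] & _); [congruence|].
  exists (t \o w); now rewrite !compmA, t1, t2.
(* Transitivity at the universal composable pair, which lives on the pullback, is the
   multiplication. *)
- intros H; apply (H _ _ (rel2 R \o pb1 (rel2 R) (rel1 R))).
  + apply mem_comp, mem_generic.
  + rewrite sq; apply mem_comp, mem_generic.
Qed.

Lemma equivalenceP (A : C) (R : relation A) :
  equivalence_rel R <->
  (forall X (f : hom X A), mem R f f) /\
  (forall X (f g : hom X A), mem R f g -> mem R g f) /\
  (forall X (f g h : hom X A), mem R f g -> mem R g h -> mem R f h).
Proof.
unfold equivalence_rel; now rewrite reflexiveP, symmetricP, transitiveP.
Qed.

Lemma equivalence_diag (A : C) : equivalence_rel (diag_rel A).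
Proof.
apply equivalenceP; repeat split; intros *; rewrite !mem_diag; congruence.
Qed.

Lemma equivalence_meet (A : C) (R S : relation A) :
  equivalence_rel R -> equivalence_rel S -> equivalence_rel (meet_rel R S).
Proof.
rewrite !equivalenceP; intros (rR & sR & tR) (rS & sS & tS).
repeat split; intros *; rewrite !mem_meet; intuition eauto.
Qed.

(** * Inverse images of relations, and alternating chains *)

Section Preimage.
Variables (A B : C) (f : hom B A) (R : relation A).

Let ff : hom (prodo B B) (prodo A A) := pairm (f \o pr1 B B) (f \o pr2 B B).

(** Monomorphisms are stable under pullback, here along [ff], which is the product of [f] with
    itself. *)
Lemma preimage_mono : mono (pb2 (rel_mor R) ff).
Proof.
destruct (pbP (rel_mor R) ff) as [sq U]; intros Z u v uv.
assert (E : pb1 (rel_mor R) ff \o u = pb1 (rel_mor R) ff \o v).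
{ apply (rel_mono (r := R)); now rewrite !compmA, sq, <- !compmA, uv. }
destruct (U _ (pb1 (rel_mor R) ff \o v) (pb2 (rel_mor R) ff \o v)) as [h [_ Uh]].
{ now rewrite !compmA, sq. }
rewrite <- (Uh u (conj E uv)); now apply Uh.
Qed.

Definition preimage_rel : relation B := Relation preimage_mono.

Lemma mem_preimage (X : C) (u v : hom X B) :
  mem preimage_rel u v <-> mem R (f \o u) (f \o v).
Proof.
assert (E : ff \o pairm u v = pairm (f \o u) (f \o v)).
{ apply prod_ext; unfold ff;
    now rewrite compmA, ?pr1_pair, ?pr2_pair, <- compmA, ?pr1_pair, ?pr2_pair. }
rewrite !mem_factor, <- E; simpl.
destruct (pbP (rel_mor R) ff) as [sq U]; split.
- intros [h <-]; exists (pb1 (rel_mor R) ff \o h); now rewrite !compmA, sq.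
- intros [h Hh]; destruct (U _ _ _ Hh) as (w & [_ H2] & _); now exists w.
Qed.

Lemma equivalence_preimage : equivalence_rel R -> equivalence_rel preimage_rel.
Proof.
rewrite !equivalenceP; intros (r & s & t).
repeat split; intros *; rewrite !mem_preimage; eauto.
Qed.

End Preimage.

(** Presents the kernel pair of [f] as an inverse image of the diagonal, so that
    [equivalence_preimage] makes it an equivalence relation. *)
Lemma mem_kernel (A B X : C) (f : hom B A) (u v : hom X B) :
  mem (preimage_rel f (diag_rel A)) u v <-> f \o u = f \o v.
Proof. now rewrite mem_preimage, mem_diag. Qed.

(* [Q] is an invariant carried along the alternating chain. *)
Lemma mem_alt_transfer (A B : C) (f : hom B A)
    (Q : forall X : C, hom X B -> Prop) :
  (forall (X Y : C) (u : hom X B) (e : hom Y X), Q X u -> Q Y (u \o e)) ->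
  forall (k : nat) (U V : relation A) (U' V' : relation B),
  (forall X (u v : hom X B), Q X u -> mem U' u v ->
     Q X v /\ mem U (f \o u) (f \o v)) ->
  (forall X (u v : hom X B), Q X u -> mem V' u v ->
     Q X v /\ mem V (f \o u) (f \o v)) ->
  forall X (u v : hom X B), Q X u ->
    mem (alt_rel U' V' k) u v -> mem (alt_rel U V k) (f \o u) (f \o v).
Proof.
(* The relations stay general in the induction because the tail of an alternating composite starts
   with the other one. *)
intros Qe; induction k as [|[|k] IH]; intros U V U' V' HU HV X u v Qu M.
- apply mem_diag in M; subst v; now apply mem_diag.
- now apply HU.
- destruct (mem_comp_rel_inv M) as (Y & e & y & Re & M1 & M2).
  (* The middle element lives over the cover [e]: [Qe] takes the invariant there, and [mem_local]
     brings the conclusion back. *)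
  apply (mem_local Re); rewrite <- !compmA.
  destruct (HU _ _ _ (Qe _ _ _ e Qu) M1) as [Qy My].
  exact (mem_comp_rel My (IH _ _ _ _ HV HU _ _ _ Qy M2)).
Qed.

Lemma alt_rel_mono (A : C) (U V U' V' : relation A) (k : nat) :
  le_rel U' U -> le_rel V' V -> le_rel (alt_rel U' V' k) (alt_rel U V k).
Proof.
rewrite !le_relP; intros HU HV X f g M.
rewrite <- (comp1m f), <- (comp1m g).
(* Transfer along the identity morphism with a trivial invariant. *)
apply (mem_alt_transfer (Q := fun _ _ => True)) with (U' := U') (V' := V');
  trivial; intros; rewrite !comp1m; auto.
Qed.

Lemma comp_rel_le_transitive (A : C) (U V W : relation A) :
  transitive_rel W -> le_rel U W -> le_rel V W -> le_rel (comp_rel U V) W.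
Proof.
rewrite transitiveP, !le_relP; intros tW HU HV X f g M.
destruct (mem_comp_rel_inv M) as (Y & e & y & Re & M1 & M2).
apply (mem_local Re); eauto.
Qed.

(** * The object of triples and the implication (i) => (ii) *)

Section Triples.
Variables (A : C) (R S T : relation A).
Hypothesis eR : equivalence_rel R.

Let B : C := pb (rel2 S) (rel1 T).
Let b : hom B A := rel1 S \o pb1 (rel2 S) (rel1 T).
Let a : hom B A := rel2 S \o pb1 (rel2 S) (rel1 T).
Let c : hom B A := rel2 T \o pb2 (rel2 S) (rel1 T).

Lemma triple_exists (X : C) (f y g : hom X A) : mem S f y -> mem T y g ->
  exists u : hom X B, b \o u = f /\ a \o u = y /\ c \o u = g.
Proof.
intros (h & <- & <-) (k & Hk & <-).
destruct (pbP (rel2 S) (rel1 T)) as [_ U].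
destruct (U _ h k) as (w & [H1 H2] & _); [congruence|].
exists w; unfold b, a, c; rewrite <- !compmA; now rewrite H1, H2.
Qed.

Lemma triple_left (X : C) (u : hom X B) : mem S (b \o u) (a \o u).
Proof. apply mem_comp, mem_comp, mem_generic. Qed.

Lemma triple_right (X : C) (u : hom X B) : mem T (a \o u) (c \o u).
Proof.
apply mem_comp; unfold a, c.
rewrite (proj1 (pbP (rel2 S) (rel1 T))); apply mem_comp, mem_generic.
Qed.

Let R' : relation B :=
  meet_rel (preimage_rel a R) (meet_rel (preimage_rel b R) (preimage_rel c R)).
Let S' : relation B := preimage_rel b (diag_rel A).
Let T' : relation B := preimage_rel c (diag_rel A).

Lemma mem_triples (X : C) (u v : hom X B) : mem R' u v <->
  mem R (a \o u) (a \o v) /\ mem R (b \o u) (b \o v) /\ mem R (c \o u) (c \o v).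
Proof. unfold R'; now rewrite !mem_meet, !mem_preimage. Qed.

(** The invariant of the chain. [R'] only compares like components of two triples; this relates the
    components within one triple. *)
Let coherent (X : C) (u : hom X B) : Prop :=
  mem R (a \o u) (b \o u) /\ mem R (a \o u) (c \o u).

Lemma coherent_comp (X Y : C) (u : hom X B) (e : hom Y X) :
  coherent u -> coherent (u \o e).
Proof.
unfold coherent; rewrite !compmA; intros []; split; now apply mem_comp.
Qed.

Lemma coherent_transport (X : C) (u v : hom X B) :
  coherent u -> mem R' u v -> coherent v.
Proof.
rewrite mem_triples; intros [ab ac] (aa & bb & cc).
apply equivalenceP in eR; destruct eR as (_ & s & t).
split; eauto.
Qed.

(** The shared first component is the intermediate point: coherence of [u] and of [v] gives the [R]
    parts, and the triples themselves give the [S] parts. *)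
Lemma step_left (X : C) (u v : hom X B) :
  coherent u -> mem (meet_rel R' S') u v ->
  coherent v /\
  mem (comp_rel (meet_rel R (op_rel S)) (meet_rel R S)) (a \o u) (a \o v).
Proof.
intros Qu M; apply mem_meet in M; destruct M as [MR MS].
pose proof (coherent_transport Qu MR) as Qv; split; [exact Qv|].
apply mem_kernel in MS.
apply mem_comp_rel with (y := b \o u); apply mem_meet; split.
- apply Qu.
- apply mem_op, triple_left.
- rewrite MS; apply (proj1 (proj2 (proj1 (equivalenceP R) eR))), Qv.
- rewrite MS; apply triple_left.
Qed.

Lemma step_right (X : C) (u v : hom X B) :
  coherent u -> mem (meet_rel R' T') u v ->
  coherent v /\
  mem (comp_rel (meet_rel R T) (meet_rel R (op_rel T))) (a \o u) (a \o v).
Proof.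
intros Qu M; apply mem_meet in M; destruct M as [MR MT].
pose proof (coherent_transport Qu MR) as Qv; split; [exact Qv|].
apply mem_kernel in MT.
apply mem_comp_rel with (y := c \o u); apply mem_meet; split.
- apply Qu.
- apply triple_right.
- rewrite MT; apply (proj1 (proj2 (proj1 (equivalenceP R) eR))), Qv.
- rewrite MT; apply mem_op, triple_right.
Qed.

Lemma jonsson_reflexive (n : nat) :
  jonsson_category n C -> reflexive_rel S -> reflexive_rel T ->
  le_rel (meet_rel R (comp_rel S T))
    (alt_rel (comp_rel (meet_rel R (op_rel S)) (meet_rel R S))
             (comp_rel (meet_rel R T) (meet_rel R (op_rel T))) (n + 1)).
Proof.
rewrite !reflexiveP; intros J rS rT; apply le_relP; intros X0 x0 z0 M.
apply mem_meet in M; destruct M as [M0 M].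
destruct (mem_comp_rel_inv M) as (X & e & y & Re & Sxy & Tyz).
apply (mem_local Re); apply (mem_comp e) in M0.
revert M0 Sxy Tyz; generalize (x0 \o e) (z0 \o e); intros x z Rxz Sxy Tyz.
destruct (triple_exists (rS _ x) (rT _ x)) as (p & pb & pa & pc).
destruct (triple_exists Sxy Tyz) as (q & qb & qa & qc).
destruct (triple_exists (rS _ z) (rT _ z)) as (r & rb & ra & rc).
assert (eR' : equivalence_rel R').
{ repeat apply equivalence_meet; now apply equivalence_preimage. }
assert (Hpr : mem (meet_rel R' (comp_rel S' T')) p r).
{ apply mem_meet; split.
  - apply mem_triples; now rewrite pa, pb, pc, ra, rb, rc.
  - apply mem_comp_rel with (y := q); apply mem_kernel; congruence. }
rewrite <- pa, <- ra.
apply (mem_alt_transfer coherent_comp step_left step_right).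
(* The chain starts coherent, since all components of [p] equal [x] and [R] is reflexive. *)
- split; rewrite pa, ?pb, ?pc; now apply equivalenceP in eR.
- revert Hpr; apply le_relP, J; try exact eR';
    apply equivalence_preimage, equivalence_diag.
Qed.

End Triples.

End Membership.

Theorem theorem3p9 (C : regular_category) (n : nat) (hn : 1 <= n) :
  jonsson_category n C <->
  (forall (A : C) (R S T : relation A),
     equivalence_rel R -> reflexive_rel S -> reflexive_rel T ->
     (R ∧ (S ∘ T) ≤
        alt_rel ((R ∧ S^op) ∘ (R ∧ S)) ((R ∧ T) ∘ (R ∧ T^op)) (n + 1))%intrel).
Proof.
split.
- intros J A R S T eR rS rT; now apply jonsson_reflexive.
- intros H A R S T eR eS eT.
  assert (op_le : forall E : relation A, equivalence_rel E ->
    le_rel (meet_rel R (op_rel E)) (meet_rel R E)).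
  { intros E (_ & sE & _); apply le_relP; intros X f g.
    rewrite !mem_meet; intros [MR ME]; split; [exact MR|].
    revert ME; now apply le_relP. }
  assert (refl : forall W : relation A, le_rel W W)
    by (intros W; now apply le_relP).
  apply le_relP; intros X f g M.
  pose proof (proj1 (le_relP _ _) (H A R S T eR (proj1 eS) (proj1 eT)) _ _ _ M)
    as M'.
  (* By [op_le], each two-fold composite has both factors inside [R ∧ S], or both inside [R ∧ T];
     transitivity of these meets absorbs it without changing the length of the chain. *)
  revert M'; apply le_relP, alt_rel_mono; apply comp_rel_le_transitive; auto;
    now apply equivalence_meet.
Qed.
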